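(* Let $Q(t)=q_0+q_1t+\cdots+q_rt^r\in\mathbb{Z}[t]$ have degree $r>0$, with $q_0$ and $q_r$ odd, and suppose that $Q(t)\bmod 2$ is irreducible in $\mathbb{Z}_2[t]$. Let $x_0,\ldots,x_{r-1}$ be integers, at least one of which is odd. For each $w\ge 1$ let $(x_n)_{n\ge 0}$ be the sequence modulo $2^w$ with these initial values defined by the linear recurrence $$q_0x_n+q_1x_{n+1}+\cdots+q_rx_{n+r}\equiv 0 \pmod{2^w}\qquad (n\ge 0),$$ and let $p_w$ be its period. Let $\lambda$ be the least positive integer such that $t^\lambda=1 \bmod (2,Q(t))$. Then: 1. if $Q(-t)$ satisfies Condition S, then $p_w\le 2^{w-2}\lambda$ for all $w\ge 2$; 2. if $Q(t)$ satisfies Condition S, then $p_w\le 2^{w-2}\lambda$ for all $w\ge 3$; 3. $p_w=2^{w-1}\lambda$ for all $w\ge 1$ if and only if neither $Q(t)$ nor $Q(-t)$ satisfies Condition S.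
   Context: $\mathbb{Z}_m$ denotes the ring of integers modulo $m$. For $A,B\in\mathbb{Z}[t]$, the notation $A=B \bmod (m,Q)$ means that $A$ and $B$ have the same image in the quotient ring $\mathbb{Z}_m[t]/Q(t)$ of polynomials with coefficients in $\mathbb{Z}_m$ modulo $Q$. Since $q_r$ is odd, the recurrence determines $x_n$ modulo $2^w$ uniquely for all $n\ge r$ from $x_0,\ldots,x_{r-1}$. The period $p_w$ is the least positive integer $p$ such that $x_{n+p}\equiv x_n\pmod{2^w}$ for all sufficiently large $n$ (equivalently, since $q_0$ is odd, for all $n\ge 0$). Condition S: a polynomial $P(t)=\sum_{j=0}^{r}p_jt^j$ of degree $r$ with integer coefficients satisfies Condition S if $$P(t)^2+P(-t)^2\equiv 2p_r P(t^2)\pmod 8,$$ as a congruence of polynomials coefficient by coefficient, where $p_r$ is the leading coefficient of $P$. (Thus for $P(t)=Q(-t)$ the leading coefficient is $(-1)^rq_r$.) *)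

(* Defs.v *)
From HB Require Import structures.
From mathcomp Require Import all_boot all_order all_algebra.

Set Implicit Arguments.
Unset Strict Implicit.
Unset Printing Implicit Defensive.

Import Order.TTheory GRing.Theory Num.Theory.
Local Open Scope ring_scope.

Definition oddz (a : int) : bool := ~~ (2 %| a)%Z.

(* A = B mod (m, Q): equality in Z_m[t]/(Q), i.e. the reductions of A and B
   differ by a multiple of Q.  Meaningful for 1 < m only, since 'Z_0 and 'Z_1
   both denote Z/2. *)
Definition eqmod_poly (m : nat) (Q A B : {poly int}) : Prop :=
  exists C : {poly 'Z_m},
    map_poly intr A - map_poly intr B = C * map_poly intr Q.

Definition least_pos (S : nat -> Prop) (k : nat) : Prop :=
  [/\ (0 < k)%N, S k & forall j : nat, (0 < j)%N -> S j -> (k <= j)%N].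

Definition eventual_shift (m : int) (u : nat -> int) (p : nat) : Prop :=
  exists N : nat, forall n : nat, (N <= n)%N -> (u (n + p)%N = u n %[mod m])%Z.

(* A sequence modulo m is given by integer representatives of its terms. *)
Definition is_period (m : int) (u : nat -> int) (p : nat) : Prop :=
  least_pos (eventual_shift m u) p.

(* P(-t) *)
Definition reflect_poly (P : {poly int}) : {poly int} := P \Po (- 'X).

Definition condition_S (P : {poly int}) : Prop :=
  forall j : nat,
    ((P ^+ 2 + reflect_poly P ^+ 2)`_j
      = ((2 * lead_coef P) *: (P \Po 'X^2))`_j %[mod 8])%Z.

(* Main.v *)
Require Import Defs.
From mathcomp Require Import all_boot all_order all_algebra.
From mathcomp Require Import ring zify.

Import Order.TTheory GRing.Theory Num.Theory.
Local Open Scope ring_scope.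

(** Everything takes place in the ideals (2 ^ k, Q) of Z[t]; a congruence
    modulo (2 ^ k, Q) is membership of a difference.  Since Q is irreducible
    modulo 2, the ideal (2, Q) is maximal, and 2 F lies in (2 ^ k.+1, Q) only if
    F lies in (2 ^ k, Q) (ideal_cancel2).

    Periods are orders.  A sequence u defines the functional F |-> u(F) on Z[t]
    with u(t ^ n) = u_n, and the recurrence says that it sends multiples of Q to
    multiples of 2 ^ w.  Because u is not 0 modulo 2 and (2, Q) is maximal, the
    largest ideal on which u vanishes modulo 2 ^ w is exactly (2 ^ w, Q)
    (seq_eval_kernel).  Hence p_w is the order of t modulo (2 ^ w, Q)
    (eventual_shift_ideal).

    Growth of the order.  Write t ^ lam = 1 + 2 A modulo Q.  Squaring raises
    the exponent k in a congruence t ^ n = 1 modulo (2 ^ k, Q) by at least one,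
    so p_w <= 2 ^ (w - 1) * lam.  If A = 0 modulo (2, Q) one doubling is saved at
    w = 2; if A = 1, that is t ^ lam = - 1 modulo (4, Q), then
    t ^ (2 lam) - 1 = 4 A (A + 1) saves one at w = 3.  For any other A in the
    field Z[t] / (2, Q) both A and A + 1 are nonzero, each squaring
    gains exactly one power of 2, and no doubling is ever saved
    (ideal_order_exact).

    Condition S detects the two exceptional cases.  Modulo (4, Q) one has
    t ^ lam = 1 iff t ^ 2 is again a root of Q (root_square_iff_order): if it is,
    t |-> t ^ 2 is an endomorphism of the quotient, and comparing it with squaring
    forces A ^ 2 = 0 modulo (2, Q); conversely Q divides t ^ lam - 1 with a
    cofactor invertible modulo (2, Q), because lam is odd and t ^ lam - 1 is
    separable modulo 2.  Moreover t ^ 2 is a root of the Graeffe transform G, where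
    G(t ^ 2) = Q(t) Q(- t), and G has the same degree as Q.  As the powers of
    t ^ 2 below that degree stay independent, Q(t ^ 2) = 0 modulo (4, Q) iff G is
    proportional to Q modulo 4, which is Condition S for Q(- t)
    (condition_S_graeffe, condition_S_root_square).  The substitution of - t for
    t exchanges t ^ lam = 1 and t ^ lam = - 1, lam being odd, and gives the criterion
    for Q(t) (condition_S_order). *)

(** * Reduction modulo 2 *)

Definition red2 (F : {poly int}) : {poly 'F_2} := map_poly intr F.

Lemma pchar_F2 : 2 \in [pchar 'F_2].
Proof. exact: pchar_Fp. Qed.

Lemma red2_eq0P (F : {poly int}) :
  red2 F = 0 <-> exists G : {poly int}, F = 2 * G.
Proof.
split=> [F0 | [G ->]]; last first.
  by rewrite /red2 rmorphM /= rmorph_nat -polyC_natr pchar_Zp // mul0r.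
have /polyOver_dvdzP[G ->]: F \is a polyOver (dvdz 2).
  apply/polyOverP=> i; move/polyP/(_ i): F0.
  rewrite coef_map coef0 /= => /eqP.
  by rewrite -(dvdz_pcharf pchar_F2).
by exists G; rewrite -mul_polyC polyC_natr.
Qed.

Lemma red2_surj (f : {poly 'F_2}) : exists F, red2 F = f.
Proof.
exists (map_poly (fun a : 'F_2 => (a : nat)%:Z) f); apply/polyP=> i.
by rewrite coef_map coef_map_id0 //= -[RHS]natr_Zp.
Qed.

(** The Frobenius endomorphism of F_2[t], with the error term kept over Z: it is
    the factor B that survives in congruences modulo 4. *)
Lemma frobenius_mod2 (F : {poly int}) :
  exists B : {poly int}, F \Po 'X^2 = F ^+ 2 + 2 * B.
Proof.
elim/poly_ind: F => [|F c [B IH]]; first by exists 0; rewrite comp_poly0; ring.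
have [d cE]: exists d : int, c - c ^+ 2 = 2 * d.
  rewrite (divz_eq c 2); set q := (c %/ 2)%Z.
  have: (0 <= c %% 2 < 2)%Z by rewrite modz_ge0 ?ltz_pmod.
  have [->|->]: (c %% 2)%Z = 0 \/ (c %% 2)%Z = 1 by lia.
    by exists (q - 2 * q ^+ 2); ring.
  by exists (- q - 2 * q ^+ 2); ring.
exists (B * 'X^2 - F * 'X * c%:P + d%:P).
rewrite comp_poly_MXaddC IH.
have: c%:P - c%:P ^+ 2 = 2 * d%:P :> {poly int}.
  by rewrite -!polyC_exp -polyCB cE polyCM polyC_natr.
by move/(canRL (subrK _))=> {1}->; ring.
Qed.

(** * The ideals (2 ^ k, Q) *)

Definition in_ideal (Q : {poly int}) (k : nat) (F : {poly int}) : Prop :=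
  exists C D : {poly int}, F = 2 ^+ k * C + D * Q.

Section Ideal.
Variable Q : {poly int}.
Implicit Types (F G : {poly int}) (k m n : nat).

Lemma idealD k F G : in_ideal Q k F -> in_ideal Q k G -> in_ideal Q k (F + G).
Proof.
by move=> [C [D ->]] [C' [D' ->]]; exists (C + C'), (D + D'); ring.
Qed.

Lemma idealMl k F G : in_ideal Q k G -> in_ideal Q k (F * G).
Proof. by move=> [C [D ->]]; exists (F * C), (F * D); ring. Qed.

Lemma idealN k F : in_ideal Q k F -> in_ideal Q k (- F).
Proof. by rewrite -mulN1r; apply: idealMl. Qed.

Lemma idealB k F G : in_ideal Q k F -> in_ideal Q k G -> in_ideal Q k (F - G).
Proof. by move=> FI /idealN; apply: idealD. Qed.

Lemma ideal_congr k F G :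
  in_ideal Q k (F - G) -> in_ideal Q k F <-> in_ideal Q k G.
Proof.
move=> FG; split=> [FI|GI]; last by rewrite -(subrK G F); apply: idealD.
by have -> : G = F - (F - G) by [ring]; apply: idealB.
Qed.

Lemma ideal_pow2 k F : in_ideal Q k (2 ^+ k * F).
Proof. by exists F, 0; ring. Qed.

Lemma ideal_gen k F : in_ideal Q k (F * Q).
Proof. by exists 0, F; ring. Qed.

Lemma idealM k m F G :
  in_ideal Q k F -> in_ideal Q m G -> in_ideal Q (k + m) (F * G).
Proof.
move=> [C [D ->]] [C' [D' ->]].
exists (C * C'), (2 ^+ k * C * D' + D * 2 ^+ m * C' + D * D' * Q).
by rewrite exprD; ring.
Qed.

Lemma idealW k m F : (k <= m)%N -> in_ideal Q m F -> in_ideal Q k F.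
Proof.
move=> km [C [D ->]]; exists (2 ^+ (m - k) * C), D.
by rewrite mulrA -exprD subnKC.
Qed.

Lemma ideal_mul2 k F : in_ideal Q k F -> in_ideal Q k.+1 (2 * F).
Proof. by apply: (@idealM 1 k 2); exists 1, 0; ring. Qed.

Lemma ideal1P F : in_ideal Q 1 F <-> exists D, red2 F = D * red2 Q.
Proof.
split=> [[C [D ->]]|[d FE]].
  have /red2_eq0P C0: exists G : {poly int}, 2 * C = 2 * G by exists C.
  exists (red2 D).
  by rewrite expr1 /red2 rmorphD [X in _ + X]rmorphM /= -/(red2 _) C0 add0r.
have [D DE] := red2_surj d.
have /red2_eq0P[C CE]: red2 (F - D * Q) = 0.
  by rewrite /red2 rmorphB rmorphM /= -!/(red2 _) DE FE subrr.
by exists C, D; rewrite expr1 -CE subrK.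
Qed.

(** With F = 1 + E, the square is 1 + 2 E + E ^ 2, and both corrections gain a
    power of 2; the exponent is at least 1 so that E ^ 2 does. *)
Lemma ideal_double k F :
  in_ideal Q k.+1 (F - 1) -> in_ideal Q k.+2 (F ^+ 2 - 1).
Proof.
move=> FI; have -> : F ^+ 2 - 1 = 2 * (F - 1) + (F - 1) ^+ 2 by ring.
apply: idealD; first exact: ideal_mul2.
by apply: (@idealW _ (k.+1 + k.+1)); [lia | apply: idealM].
Qed.

Lemma ideal_iter_double k v F :
  in_ideal Q k.+1 (F - 1) -> in_ideal Q (k.+1 + v) (F ^+ (2 ^ v) - 1).
Proof.
move=> FI; elim: v => [|v IH]; first by rewrite addn0.
by rewrite expnSr exprM addnS; apply: ideal_double.
Qed.

Lemma ideal_expr1 k n F :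
  in_ideal Q k (F - 1) -> in_ideal Q k (F ^+ n - 1).
Proof. by move=> FI; rewrite subrX1 mulrC; apply: idealMl. Qed.

Hypothesis Q_irr : irreducible_poly (red2 Q).

Lemma ideal1_proper : ~ in_ideal Q 1 1.
Proof.
case/ideal1P=> d; rewrite /red2 rmorph1 => /esym dE.
have /irredp_neq0 Q0 := Q_irr; case: (Q_irr) => Q1 _.
have : red2 Q %| 1 by apply/dvdpP; exists d; rewrite dE.
by rewrite dvdp1 => /eqP sQ; rewrite sQ in Q1.
Qed.

Lemma ideal1_prime F G :
  in_ideal Q 1 (F * G) -> in_ideal Q 1 F \/ in_ideal Q 1 G.
Proof.
rewrite !ideal1P /red2 rmorphM /= -!/(red2 _) => /dvdpP FG.
have [QF|] := boolP (red2 Q %| red2 F); first by left; apply/dvdpP.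
rewrite -irreducible_poly_coprime // => /Gauss_dvdpr QG.
by right; apply/dvdpP; rewrite -QG.
Qed.

(** The quotient by (2, Q) is a field. *)
Lemma ideal1_or_inv F :
  in_ideal Q 1 F \/ exists G, in_ideal Q 1 (G * F - 1).
Proof.
have [/dvdpP/ideal1P|] := boolP (red2 Q %| red2 F); first by left.
rewrite -irreducible_poly_coprime // => /Bezout_eq1_coprimepP[[a b] /= abE].
have [B BE] := red2_surj b; right; exists B; apply/ideal1P; exists (- a).
by rewrite /red2 rmorphB rmorphM rmorph1 /= -!/(red2 _) BE -abE; ring.
Qed.

(** If 2 F = 2 ^ k.+1 C + D Q, then D Q vanishes modulo 2, and so does D because
    F_2[t] is a domain. *)
Lemma ideal_cancel2 k F : in_ideal Q k.+1 (2 * F) <-> in_ideal Q k F.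
Proof.
split=> [[C [D FE]]|]; last exact: ideal_mul2.
have /red2_eq0P[D' DE]: red2 D = 0.
  have /red2_eq0P/eqP: exists G : {poly int}, D * Q = 2 * G.
    exists (F - 2 ^+ k * C).
    have -> : D * Q = 2 * F - 2 ^+ k.+1 * C by rewrite FE; ring.
    by rewrite exprS; ring.
  rewrite /red2 rmorphM /= mulf_eq0 -!/(red2 _) (negPf (irredp_neq0 Q_irr)).
  by rewrite orbF => /eqP.
exists C, D'; apply: (@mulfI _ (2 : {poly int})).
  by rewrite -polyC_natr polyC_eq0.
by rewrite FE DE exprS; ring.
Qed.

(** From exponent 2 on, squaring gains exactly one power of 2: the term
    (F - 1) ^ 2 gains at least two, so 2 (F - 1) decides. *)
Lemma ideal_double_lift k F : (2 <= k)%N ->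
  in_ideal Q k (F - 1) -> in_ideal Q k.+2 (F ^+ 2 - 1) ->
  in_ideal Q k.+1 (F - 1).
Proof.
move=> k2 FI F2I; apply/(ideal_cancel2 k.+1).
have -> : 2 * (F - 1) = F ^+ 2 - 1 - (F - 1) ^+ 2 by ring.
by apply: idealB => //; apply: (@idealW _ (k + k)); [lia | apply: idealM].
Qed.

(** At exponent 1 the two corrections have equal weight: for F = 1 + 2 A,
    F ^ 2 - 1 = 4 A (A + 1), and the primality of (2, Q) leaves A = 0 or A = 1. *)
Lemma ideal_sqr_lift F :
  in_ideal Q 1 (F - 1) -> in_ideal Q 3 (F ^+ 2 - 1) ->
  in_ideal Q 2 (F - 1) \/ in_ideal Q 2 (F + 1).
Proof.
move=> [A [D FE]] F3.
have {}FE : F = 1 + 2 * A + D * Q by rewrite -(subrK 1 F) FE; ring.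
have: in_ideal Q 3 (2 * (2 * (A * (A + 1)))).
  apply: (proj1 (ideal_congr _ _ _ _) F3).
  have -> : F ^+ 2 - 1 - 2 * (2 * (A * (A + 1))) = (2 + 4 * A + D * Q) * D * Q.
    by rewrite FE; ring.
  exact: ideal_gen.
move/ideal_cancel2/ideal_cancel2/ideal1_prime=> [AI|AI]; [left|right].
  by rewrite FE; have -> : 1 + 2 * A + D * Q - 1 = 2 * A + D * Q by [ring];
     apply: idealD (ideal_gen _ _); apply/ideal_cancel2.
rewrite FE; have -> : 1 + 2 * A + D * Q + 1 = 2 * (A + 1) + D * Q by ring.
by apply: idealD (ideal_gen _ _); apply/ideal_cancel2.
Qed.

Lemma ideal_order_exact v F :
  in_ideal Q 1 (F - 1) -> ~ in_ideal Q 2 (F - 1) -> ~ in_ideal Q 2 (F + 1) ->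
  ~ in_ideal Q v.+2 (F ^+ (2 ^ v) - 1).
Proof.
move=> F1 nF nF'; elim: v => [|[|v] IH] //.
  by rewrite expn1 => /(ideal_sqr_lift F F1) [].
rewrite expnSr exprM => F2; apply: IH; apply: ideal_double_lift F2 => //.
by have := ideal_iter_double 0 v.+1 F F1; rewrite add1n.
Qed.

End Ideal.

(** * The order of t and the root t ^ 2 of Q *)

Section Order.
Variable Q : {poly int}.
Hypothesis Q_irr : irreducible_poly (red2 Q).

Lemma order_dvd w d n :
  least_pos (fun k => in_ideal Q w ('X^k - 1)) d ->
  in_ideal Q w ('X^n - 1) -> (d %| n)%N.
Proof.
move=> [d0 dI dmin]; rewrite {1}(divn_eq n d) => nI.
have rI : in_ideal Q w ('X^(n %% d) - 1).
  have -> : 'X^(n %% d) - 1 = ('X^(n %/ d * d + n %% d) - 1)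
      - 'X^(n %% d) * ('X^d ^+ (n %/ d) - 1) :> {poly int}.
    by rewrite exprD mulnC exprM; ring.
  by apply: idealB => //; apply: idealMl; apply: ideal_expr1.
have := ltn_pmod n d0; rewrite /dvdn; case: posnP => // r0.
by rewrite ltnNge dmin.
Qed.

(** Were lam even, (t ^ (lam / 2) - 1) ^ 2 would vanish modulo (2, Q), and
    primality would give a smaller exponent. *)
Lemma order_odd lam :
  least_pos (fun k => in_ideal Q 1 ('X^k - 1)) lam -> odd lam.
Proof.
move=> [l0 lI lmin]; apply: contraT => /even_halfK lE.
have : in_ideal Q 1 (('X^(lam./2) - 1) * ('X^(lam./2) - 1)).
  have -> : ('X^(lam./2) - 1) * ('X^(lam./2) - 1) =
    ('X^lam - 1) - 2 ^+ 1 * ('X^(lam./2) - 1) :> {poly int}.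
    by rewrite -{3}lE -muln2 exprM; ring.
  by apply: idealB lI (ideal_pow2 _ _ _).
move=> /(ideal1_prime _ Q_irr) HI.
have {HI} /lmin : in_ideal Q 1 ('X^(lam./2) - 1) by case: HI.
by lia.
Qed.

Variable lam : nat.
Hypotheses (lam_odd : odd lam) (lamI : in_ideal Q 1 ('X^lam - 1)).

Lemma X_ideal1 : ~ in_ideal Q 1 'X.
Proof.
move=> XI; apply: (ideal1_proper _ Q_irr).
have -> : 1 = 'X^(lam.-1) * 'X - ('X^lam - 1) :> {poly int}.
  by case: lam lam_odd => //= n _; rewrite exprSr; ring.
by apply: idealB => //; apply: idealMl.
Qed.

Lemma Xn_ideal1 n : ~ in_ideal Q 1 'X^n.
Proof.
elim: n => [|n IH]; first by rewrite expr0; apply: ideal1_proper.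
by rewrite exprS => /(ideal1_prime _ Q_irr) [/X_ideal1|].
Qed.

(** Separability of t ^ lam - 1 modulo 2: a double factor Q would divide the
    derivative lam t ^ (lam - 1), and lam is odd. *)
Lemma cofactor_notin_ideal k C S :
  'X^lam - 1 = 2 ^+ k.+1 * C + S * Q -> ~ in_ideal Q 1 S.
Proof.
move=> FE [A [B SE]]; apply: (Xn_ideal1 lam.-1).
have : in_ideal Q 1 ('X^lam - 1)^`().
  rewrite FE SE exprS expr1 !derivE.
  exists (2 ^+ k * C^`() + A^`() * Q + A * Q^`()), (B^`() * Q + B * Q^`() + B * Q^`()).
  by rewrite -[2 : {poly int}]polyC_natr -polyC_exp !derivE expr1; ring.
rewrite derivB derivXn derivC subr0 -mulr_natl.
rewrite -[in X in X%:R](odd_double_half lam) lam_odd => H.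
have -> : 'X^(lam.-1) = (1 + lam./2.*2)%:R * 'X^(lam.-1)
    - 2 ^+ 1 * ((lam./2)%:R * 'X^(lam.-1)) :> {poly int}.
  by rewrite -muln2 natrD natrM; ring.
by apply: idealB H (ideal_pow2 _ _ _).
Qed.

(** Left to right, applying t |-> t ^ 2 to t ^ lam = 1 + 2 A gives
    t ^ (2 lam) = 1 + 2 A ^ 2 modulo (4, Q), while squaring gives 1; hence A = 0
    modulo (2, Q).  Right to left, substituting t ^ 2 in t ^ lam - 1 = 4 C + S Q
    makes Q(t ^ 2) S(t ^ 2) vanish; now Q(t ^ 2) = 2 B modulo Q, and S(t ^ 2) is
    congruent to S ^ 2, which is invertible modulo 2. *)
Lemma root_square_iff_order :
  in_ideal Q 2 (Q \Po 'X^2) <-> in_ideal Q 2 ('X^lam - 1).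
Proof.
have compX k : ('X^k - 1) \Po 'X^2 = ('X^k) ^+ 2 - 1 :> {poly int}.
  by rewrite comp_polyB comp_Xn_poly -[1]/(1%:P) comp_polyC -!exprM mulnC.
split=> [QI|[C [S SE]]].
  have [A [D AE]] := lamI; have [B BE] := frobenius_mod2 A.
  have AI : in_ideal Q 2 (2 * A ^+ 2).
    have -> : 2 * A ^+ 2
        = ('X^lam) ^+ 2 - 1 - 2 ^+ 2 * B - (D \Po 'X^2) * (Q \Po 'X^2).
      rewrite -compX AE expr1 comp_polyD !comp_polyM -polyC_natr comp_polyC.
      by rewrite polyC_natr BE; ring.
    apply: idealB; last exact: idealMl.
    by apply: idealB (ideal_pow2 _ _ _); apply: ideal_double.
  have {}AI : in_ideal Q 1 A.
    by move/(ideal_cancel2 _ Q_irr): AI; rewrite expr2 => /(ideal1_prime _ Q_irr) [].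
  by rewrite AE expr1; apply: idealD (ideal_gen _ _ _); apply: ideal_mul2.
have nS := cofactor_notin_ideal _ _ _ SE.
have [B BE] := frobenius_mod2 Q; have [B' BE'] := frobenius_mod2 S.
have: in_ideal Q 2 (2 * (B * (S \Po 'X^2))).
  have -> : 2 * (B * (S \Po 'X^2)) = 'X^lam ^+ 2 - 1 - 2 ^+ 2 * (C \Po 'X^2)
      - (S \Po 'X^2) * Q * Q.
    rewrite -compX SE comp_polyD !comp_polyM BE -natrX -polyC_natr comp_polyC.
    by rewrite polyC_natr natrX; ring.
  apply: idealB (ideal_gen _ _ _).
  by apply: idealB (ideal_pow2 _ _ _); apply: ideal_double.
move/(ideal_cancel2 _ Q_irr)/(ideal1_prime _ Q_irr) => [BI|].
  rewrite BE expr2; apply: idealD (ideal_gen _ _ _) _; exact: ideal_mul2.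
rewrite BE' => SI; case: nS.
have : in_ideal Q 1 (S * S).
  have -> : S * S = S ^+ 2 + 2 * B' - 2 ^+ 1 * B' by ring.
  exact: idealB (ideal_pow2 _ _ _).
by case/(ideal1_prime _ Q_irr).
Qed.

End Order.

(** * Condition S and the Graeffe transform *)

Lemma dvd_coefP (m : nat) (F : {poly int}) :
  (forall j, (m %| F`_j)%Z) <-> exists C, F = m%:R * C.
Proof.
split=> [mF|[C ->] j]; last first.
  by rewrite -polyC_natr coefCM natz dvdz_mulr.
have /polyOver_dvdzP[C ->]: F \is a polyOver (dvdz m) by apply/polyOverP.
by exists C; rewrite -mul_polyC -polyC_natr natz.
Qed.

Lemma reflect_even_odd F :
  reflect_poly F = (even_poly F \Po 'X^2) - (odd_poly F \Po 'X^2) * 'X.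
Proof.
rewrite /reflect_poly -{1}(poly_even_odd F) comp_polyD comp_polyM comp_polyX.
by rewrite -!comp_polyA !comp_Xn_poly sqrrN mulrN.
Qed.

Lemma reflect_polyK : involutive reflect_poly.
Proof.
move=> F; rewrite /reflect_poly -comp_polyA.
by rewrite raddfN /= comp_polyX opprK comp_polyXr.
Qed.

Lemma reflect_sqr F : exists C, reflect_poly F ^+ 2 = F ^+ 2 + 4 * C.
Proof.
exists (- (even_poly F \Po 'X^2) * (odd_poly F \Po 'X^2) * 'X).
rewrite reflect_even_odd; move: (poly_even_odd F).
by move: (even_poly F) (odd_poly F) => U V <-; ring.
Qed.

(** The norm of F(t) with respect to t |-> - t, as a polynomial in t ^ 2. *)
Definition graeffe (F : {poly int}) : {poly int} :=
  even_poly F ^+ 2 - odd_poly F ^+ 2 * 'X.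

Lemma graeffe_sqr F : graeffe F \Po 'X^2 = F * reflect_poly F.
Proof.
rewrite reflect_even_odd /graeffe; move: (poly_even_odd F).
move: (even_poly F) (odd_poly F) => U V <-.
by rewrite !expr2 comp_polyB !comp_polyM comp_polyX; ring.
Qed.

Lemma coef_compX2 (F : {poly int}) j : (F \Po 'X^2)`_(j * 2) = F`_j.
Proof. by rewrite coef_comp_poly_Xn // dvdn_mull // mulnK. Qed.

(** Write F = U(t ^ 2) + t V(t ^ 2).  Then F(t) ^ 2 + F(- t) ^ 2 is twice the
    value at y = t ^ 2 of U(y) ^ 2 + y V(y) ^ 2, so Condition S for F(- t) says
    that U(y) ^ 2 + y V(y) ^ 2 = c F(- y) modulo 4, where c is the leading
    coefficient of F(- t).  Replacing y by - y changes U ^ 2 and V ^ 2 only by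
    multiples of 4, and turns the left-hand side into the Graeffe transform. *)
Lemma condition_S_graeffe F :
  condition_S (reflect_poly F) <->
  exists C, graeffe F - lead_coef (reflect_poly F) *: F = 4 * C.
Proof.
set c := lead_coef _.
pose E := even_poly F ^+ 2 + odd_poly F ^+ 2 * 'X - c *: reflect_poly F.
have SE : condition_S (reflect_poly F) <-> exists C, E = 4 * C.
  have EE : reflect_poly F ^+ 2 + reflect_poly (reflect_poly F) ^+ 2
     - (2 * c) *: (reflect_poly F \Po 'X^2) = 2 * (E \Po 'X^2).
    have sqrE : reflect_poly F ^+ 2 + F ^+ 2 = 2 * (even_poly F \Po 'X^2) ^+ 2
        + 2 * (odd_poly F \Po 'X^2) ^+ 2 * 'X^2.
      rewrite reflect_even_odd; move: (poly_even_odd F).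
      by move: (even_poly F) (odd_poly F) => U V <-; ring.
    rewrite reflect_polyK sqrE /E comp_polyB comp_polyZ comp_polyD !expr2.
    rewrite !comp_polyM comp_polyX.
    by rewrite -!mul_polyC polyCM polyC_natr; ring.
  rewrite /condition_S -/c; split=> [S | [C EC] j].
    apply/(dvd_coefP 4) => j; rewrite -(@dvdz_mul2l 2) //.
    have := S (j * 2)%N; move/eqP; rewrite eqz_mod_dvd -coefB EE.
    by rewrite -polyC_natr coefCM coef_compX2.
  apply/eqP; rewrite eqz_mod_dvd -coefB EE EC; move: j; apply/(dvd_coefP 8).
  by exists (C \Po 'X^2); rewrite comp_polyM -polyC_natr comp_polyC polyC_natr; ring.
rewrite {}SE.
have [A AE] := reflect_sqr (even_poly F).
have [B BE] := reflect_sqr (odd_poly F).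
have RE : reflect_poly E = graeffe F - c *: F + 4 * (A - B * 'X).
  rewrite {1}/reflect_poly /E !expr2 comp_polyB comp_polyZ comp_polyD.
  rewrite !comp_polyM comp_polyX -!/(reflect_poly _) -!expr2 reflect_polyK AE BE.
  by rewrite /graeffe; ring.
have refl4 G : reflect_poly (4 * G) = 4 * reflect_poly G.
  by rewrite /reflect_poly comp_polyM -polyC_natr comp_polyC.
split=> -[C CE].
  exists (reflect_poly C - (A - B * 'X)); rewrite mulrBr -refl4 -CE RE; ring.
exists (reflect_poly (C + (A - B * 'X))).
by rewrite -refl4 mulrDr -CE -RE reflect_polyK.
Qed.

Lemma size_reflect F : size (reflect_poly F) = size F.
Proof. by rewrite size_comp_poly2 // size_polyN size_polyX. Qed.

Lemma red2_reflect F : red2 (reflect_poly F) = red2 F.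
Proof.
rewrite /red2 /reflect_poly map_comp_poly rmorphN /= map_polyX.
have -> : - 'X = 'X :> {poly 'F_2}.
  apply/eqP; rewrite eq_sym -addr_eq0 -mulr2n -mulr_natl -polyC_natr.
  by rewrite pchar_Zp // mul0r.
by rewrite comp_polyXr.
Qed.

Lemma oddz_lead_reflect F : oddz (lead_coef F) -> oddz (lead_coef (reflect_poly F)).
Proof.
rewrite /oddz /reflect_poly lead_coef_comp ?size_polyN ?size_polyX //.
by rewrite lead_coefN lead_coefX !dvdzE abszM abszX exp1n muln1.
Qed.

Lemma oddz_sqr (c : int) : oddz c -> exists d : int, c ^+ 2 = 1 + 4 * d.
Proof.
move=> c_odd; have c1 : (c %% 2)%Z = 1.
  have : (0 <= c %% 2 < 2)%Z by rewrite modz_ge0 ?ltz_pmod.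
  by move: c_odd; rewrite /oddz => /dvdz_mod0P; lia.
by rewrite (divz_eq c 2) c1; set q := (c %/ 2)%Z; exists (q ^+ 2 + q); ring.
Qed.

Section ConditionS.
Variable Q : {poly int}.
Hypotheses (Q_irr : irreducible_poly (red2 Q)) (Q_odd : oddz (lead_coef Q)).

Lemma size_red2 : size (red2 Q) = size Q.
Proof.
apply: size_map_poly_id0; rewrite -(dvdz_pcharf pchar_F2); exact: Q_odd.
Qed.

(** The powers of t ^ 2 below the degree of Q stay independent modulo
    (2 ^ k, Q).  Modulo 2 this is the injectivity of Frobenius on the field; the
    exponent is then raised by dividing H by 2. *)
Lemma square_eval_small k (H : {poly int}) :
  (size H < size Q)%N -> in_ideal Q k (H \Po 'X^2) ->
  exists C, H = 2 ^+ k * C.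
Proof.
elim: k H => [|k IH] H sH HI; first by exists H; rewrite mul1r.
have [B BE] := frobenius_mod2 H.
have {B BE} /ideal1P[d dE]: in_ideal Q 1 H.
  have : in_ideal Q 1 (H * H).
    have -> : H * H = H \Po 'X^2 - 2 ^+ 1 * B by rewrite BE; ring.
    by apply: idealB (ideal_pow2 _ _ _); apply: idealW HI.
  by case/(ideal1_prime _ Q_irr).
have /red2_eq0P[H' HE]: red2 H = 0.
  apply/eqP; apply: contraTT sH => nz; rewrite -leqNgt -size_red2.
  have /(dvdp_leq nz) /leq_trans: red2 Q %| red2 H by apply/dvdpP; exists d.
  by apply; apply: size_poly.
have [||C CE] := IH H'.
- apply: leq_ltn_trans sH; rewrite HE -polyC_natr mul_polyC.
  by rewrite size_scale.
- apply/(ideal_cancel2 _ Q_irr).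
  by move: HI; rewrite HE comp_polyM -polyC_natr comp_polyC.
by exists C; rewrite HE CE exprS mulrA.
Qed.

(** Let H be the difference of the Graeffe transform and c Q, where c is the
    leading coefficient of Q(- t).  At t ^ 2 the Graeffe transform is a multiple
    of Q, so H(t ^ 2) = 0 iff Q(t ^ 2) = 0 modulo (4, Q), c being odd; the
    leading terms cancel in H, so H is small enough for its value at t ^ 2 to
    determine it. *)
Lemma condition_S_root_square :
  condition_S (reflect_poly Q) <-> in_ideal Q 2 (Q \Po 'X^2).
Proof.
rewrite condition_S_graeffe; set c := lead_coef (reflect_poly Q).
set H := graeffe Q - c *: Q.
have HX : H \Po 'X^2 = reflect_poly Q * Q - c%:P * (Q \Po 'X^2).
  by rewrite /H comp_polyB graeffe_sqr comp_polyZ mul_polyC mulrC.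
split=> [[C CE]|QI].
  have [d dE] := oddz_sqr _ (oddz_lead_reflect _ Q_odd).
  have -> : Q \Po 'X^2 = c%:P * reflect_poly Q * Q - 2 ^+ 2 * (c%:P * (C \Po 'X^2)
     + d%:P * (Q \Po 'X^2)).
    have : c%:P ^+ 2 = 1 + 4 * d%:P :> {poly int}.
      by rewrite -polyC_exp dE polyCD polyCM polyC_natr.
    have : 4 * (C \Po 'X^2) = reflect_poly Q * Q - c%:P * (Q \Po 'X^2).
      by rewrite -HX CE comp_polyM -polyC_natr comp_polyC.
    move=> E1 E2; have -> : 2 ^+ 2 * (c%:P * (C \Po 'X^2) + d%:P * (Q \Po 'X^2)) =
      c%:P * (4 * (C \Po 'X^2)) + (1 + 4 * d%:P - 1) * (Q \Po 'X^2) by ring.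
    by rewrite E1 -E2; ring.
  exact: idealB (ideal_gen _ _ _) (ideal_pow2 _ _ _).
have [||C CE] := square_eval_small 2 H.
- have [n sQ] : exists n, size Q = n.+1.
    exists (size Q).-1; rewrite prednK // lt0n size_poly_eq0 -lead_coef_eq0.
    by apply: contraTneq Q_odd => ->.
  (* The coefficient of H at j is that of H(t ^ 2) at 2 j, which is read off
     from Q(t) Q(- t); only j = n, where the leading terms cancel, is not zero
     for reasons of degree. *)
  rewrite sQ ltnS; apply/leq_sizeP => j jn; rewrite -(coef_compX2 H) HX.
  rewrite coefB coefCM coef_compX2.
  have szM : size (reflect_poly Q * Q) = (n * 2).+1.
    rewrite size_mul -?size_poly_eq0 ?size_reflect ?sQ //; lia.
  case: (ltngtP j n) jn => // [jn|->] _.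
    by rewrite !nth_default ?mulr0 ?subr0 // ?szM ?sQ; lia.
  have := lead_coefM (reflect_poly Q) Q.
  by rewrite {1}lead_coefE szM [lead_coef Q]lead_coefE sQ /= => ->; rewrite subrr.
- rewrite HX; apply: idealB (ideal_gen _ _ _) _; exact: idealMl.
by exists C; rewrite CE; ring.
Qed.

End ConditionS.

(** * Linear recurrences as functionals *)

Definition seq_eval (u : nat -> int) (F : {poly int}) : int :=
  \sum_(i < size F) F`_i * u i.

Section SeqEval.
Variable u : nat -> int.
Implicit Types F G : {poly int}.

Lemma seq_eval_widen n F : (size F <= n)%N ->
  seq_eval u F = \sum_(i < n) F`_i * u i.
Proof.
move=> sF; rewrite /seq_eval (big_ord_widen n (fun i => F`_i * u i)) //.
rewrite big_mkcond /=; apply: eq_bigr => i _; case: ltnP => // Fi.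
by rewrite nth_default // mul0r.
Qed.

Lemma seq_evalD F G : seq_eval u (F + G) = seq_eval u F + seq_eval u G.
Proof.
pose n := maxn (size F) (size G).
rewrite !(@seq_eval_widen n) ?leq_maxl ?leq_maxr ?size_polyD // -big_split /=.
by apply: eq_bigr => i _; rewrite coefD mulrDl.
Qed.

Lemma seq_evalCM a F : seq_eval u (a%:P * F) = a * seq_eval u F.
Proof.
rewrite (@seq_eval_widen (size F)); last first.
  by rewrite mul_polyC size_scale_leq.
by rewrite /seq_eval mulr_sumr; apply: eq_bigr => i _; rewrite coefCM mulrA.
Qed.

Lemma seq_eval_pow2M k F : seq_eval u (2 ^+ k * F) = 2 ^+ k * seq_eval u F.
Proof. by rewrite -seq_evalCM polyC_exp polyC_natr. Qed.

Lemma seq_evalN F : seq_eval u (- F) = - seq_eval u F.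
Proof. by rewrite -mulN1r -polyC1 -polyCN seq_evalCM mulN1r. Qed.

Lemma seq_eval_XnM n F :
  seq_eval u ('X^n * F) = \sum_(j < size F) F`_j * u (n + j)%N.
Proof.
rewrite (@seq_eval_widen (n + size F)); last first.
  by apply: leq_trans (size_polyMleq _ _) _; rewrite size_polyXn.
rewrite big_split_ord /= big1 ?add0r => [|i _].
  by apply: eq_bigr => j _; rewrite coefXnM ltnNge leq_addr addKn.
by rewrite coefXnM ltn_ord mul0r.
Qed.

Lemma seq_evalXn n : seq_eval u 'X^n = u n.
Proof. by rewrite -['X^n]mulr1 seq_eval_XnM size_poly1 big_ord1 coef1 mul1r addn0. Qed.

Lemma seq_eval_dvdM (m : int) G :
  (forall n, (m %| seq_eval u ('X^n * G))%Z) ->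
  forall F, (m %| seq_eval u (F * G))%Z.
Proof.
move=> mG F; rewrite -[G]mul1r -(expr0 'X); move: 0%N.
elim/poly_ind: F => [|F c IH] n.
  by rewrite mul0r -(mulr0 0%:P) seq_evalCM mul0r dvdz0.
have -> : (F * 'X + c%:P) * ('X^n * G) = F * ('X^(n.+1) * G) + c%:P * ('X^n * G).
  by rewrite exprS; ring.
by rewrite seq_evalD seq_evalCM rpredD // dvdz_mull.
Qed.

Variables (Q : {poly int}) (w : nat).
Hypothesis Q_irr : irreducible_poly (red2 Q).
Hypothesis u_rec : forall F, (2 ^+ w %| seq_eval u (F * Q))%Z.
Hypothesis u_odd : exists i, oddz (u i).

Lemma seq_eval_ideal F : in_ideal Q w F -> (2 ^+ w %| seq_eval u F)%Z.
Proof.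
move=> [C [D ->]]; rewrite seq_evalD seq_eval_pow2M.
by rewrite rpredD // dvdz_mulr.
Qed.

(** By induction G = 2 ^ m A + D Q, and then u(F A) is even for every F.  If A
    were invertible modulo (2, Q), all terms of u would be even. *)
Lemma seq_eval_kernel m G : (m <= w)%N ->
  (forall F, (2 ^+ m %| seq_eval u (F * G))%Z) -> in_ideal Q m G.
Proof.
elim: m G => [|m IH] G mw mG; first by exists G, 0; ring.
have dvd2 a b (c : int) : (b <= a)%N -> (2 ^+ a %| c)%Z -> (2 ^+ b %| c)%Z.
  by move=> ba; apply: dvdz_trans; rewrite -(subnK ba) exprD dvdz_mull.
have [|F|A [D GE]] := IH G; [exact: ltnW | exact: dvd2 (mG F) | ].
have AF F : (2 %| seq_eval u (F * A))%Z.
  rewrite -(@dvdz_mul2l (2 ^+ m)) ?expf_neq0 // -exprSr -seq_eval_pow2M.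
  have -> : 2 ^+ m * (F * A) = F * G - F * D * Q by rewrite GE; ring.
  by rewrite seq_evalD seq_evalN rpredB //; apply: dvd2 (u_rec _).
have [AI|[B [C [E BE]]]] := ideal1_or_inv _ Q_irr A.
  rewrite GE; apply: idealD (ideal_gen _ _ _).
  by rewrite -addn1; apply: idealM => //; rewrite -[2 ^+ m]mulr1; apply: ideal_pow2.
have [i /negP[]] := u_odd; rewrite -seq_evalXn.
have -> : 'X^i = 'X^i * B * A - 2 ^+ 1 * ('X^i * C) - 'X^i * E * Q :> {poly int}.
  have -> : 'X^i * B * A = 'X^i * (B * A - 1) + 'X^i by ring.
  by rewrite BE; ring.
rewrite !seq_evalD !seq_evalN seq_eval_pow2M !rpredB ?dvdz_mulr //.
by rewrite -[2]expr1; apply: dvd2 (u_rec _); lia.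
Qed.

(** An eventual shift only controls t ^ N (t ^ k - 1); the factor t ^ N is
    removed with the help of an exponent M >= N such that t ^ M = 1 modulo
    (2 ^ w, Q). *)
Lemma eventual_shift_ideal lam k : (0 < lam)%N -> in_ideal Q 1 ('X^lam - 1) ->
  eventual_shift (2 ^+ w) u k <-> in_ideal Q w ('X^k - 1).
Proof.
have shiftE n : u (n + k)%N - u n = seq_eval u ('X^n * ('X^k - 1)).
  by rewrite mulrBr mulr1 -exprD seq_evalD seq_evalN !seq_evalXn.
move=> lam0 lamI; split=> [[N uN]|kI]; last first.
  exists 0%N => n _; apply/eqP; rewrite eqz_mod_dvd shiftE.
  exact/seq_eval_ideal/idealMl.
have NI : in_ideal Q w ('X^N * ('X^k - 1)).
  apply: seq_eval_kernel => //; apply: seq_eval_dvdM => n.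
  rewrite mulrA -exprD -shiftE -eqz_mod_dvd; apply/eqP/uN; exact: leq_addl.
pose M := (lam * 2 ^ w * N)%N.
have NM : (N <= M)%N by rewrite leq_pmull // muln_gt0 lam0 expn_gt0.
have MI : in_ideal Q w ('X^M - 1).
  rewrite exprM; apply: ideal_expr1; rewrite exprM.
  by apply: (@idealW _ _ (1 + w)); rewrite ?leq_addl //; apply: ideal_iter_double.
have -> : 'X^k - 1 = 'X^(M - N) * ('X^N * ('X^k - 1)) - ('X^k - 1) * ('X^M - 1)
  :> {poly int} by rewrite mulrA -exprD subnK //; ring.
by apply: idealB; apply: idealMl.
Qed.

End SeqEval.

Lemma least_pos_iff (S S' : nat -> Prop) k :
  (forall j, S j <-> S' j) -> least_pos S k -> least_pos S' k.
Proof.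
move=> SS' [k0 Sk kmin]; split=> //; first exact/SS'.
by move=> j j0 /SS'; apply: kmin.
Qed.

(** * Condition S in terms of the order of t *)

Lemma ideal_reflect Q k F :
  in_ideal Q k F -> in_ideal (reflect_poly Q) k (reflect_poly F).
Proof.
move=> [C [D ->]]; exists (reflect_poly C), (reflect_poly D).
rewrite /reflect_poly comp_polyD !comp_polyM.
by rewrite -natrX -polyC_natr comp_polyC.
Qed.

Lemma condition_S_reflect_order Q lam :
  irreducible_poly (red2 Q) -> oddz (lead_coef Q) -> odd lam ->
  in_ideal Q 1 ('X^lam - 1) ->
  condition_S (reflect_poly Q) <-> in_ideal Q 2 ('X^lam - 1).
Proof.
move=> Q_irr Q_odd lam_odd lamI.
by rewrite condition_S_root_square // (root_square_iff_order _ _ lam).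
Qed.

(** The previous criterion for Q(- t), transported by t |-> - t: since lam is
    odd, this sends t ^ lam - 1 to - (t ^ lam + 1). *)
Lemma condition_S_order Q lam :
  irreducible_poly (red2 Q) -> oddz (lead_coef Q) -> odd lam ->
  in_ideal Q 1 ('X^lam - 1) ->
  condition_S Q <-> in_ideal Q 2 ('X^lam + 1).
Proof.
move=> Q_irr Q_odd lam_odd lamI.
have reflX (a : int) : reflect_poly ('X^lam + a%:P) = - ('X^lam - a%:P).
  rewrite /reflect_poly comp_polyD comp_Xn_poly comp_polyC exprNn -signr_odd.
  by rewrite lam_odd expr1; ring.
have lamI' : in_ideal (reflect_poly Q) 1 ('X^lam - 1).
  by move: lamI; rewrite !ideal1P red2_reflect.
rewrite -{1}(reflect_polyK Q) (condition_S_reflect_order _ lam) ?red2_reflect //;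
  last exact: oddz_lead_reflect.
split=> /ideal_reflect/idealN; rewrite -polyC1.
  by rewrite reflect_polyK -polyCN reflX opprK polyCN opprK.
by rewrite reflX opprK.
Qed.

Theorem theorem2 (r : nat) (Q : {poly int}) (x0 : 'I_r -> int)
    (x : nat -> nat -> int) (p : nat -> nat) (lam : nat)
    (r_gt0 : (0 < r)%N)
    (degQ : size Q = r.+1)
    (q0_odd : oddz Q`_0)
    (qr_odd : oddz Q`_r)
    (Q_irr : irreducible_poly (map_poly intr Q : {poly 'F_2}))
    (x0_odd : exists i : 'I_r, oddz (x0 i))
    (x_init : forall w : nat, (1 <= w)%N -> forall i : 'I_r,
       (x w i = x0 i %[mod 2 ^+ w])%Z)
    (x_rec : forall w : nat, (1 <= w)%N -> forall n : nat,
       (\sum_(j < r.+1) Q`_j * x w (n + j)%N = 0 %[mod 2 ^+ w])%Z)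
    (p_period : forall w : nat, (1 <= w)%N -> is_period (2 ^+ w) (x w) (p w))
    (lam_order : least_pos (fun k : nat => eqmod_poly 2 Q 'X^k 1) lam) :
  [/\ condition_S (reflect_poly Q) ->
        forall w : nat, (2 <= w)%N -> (p w <= 2 ^ (w - 2) * lam)%N,
      condition_S Q ->
        forall w : nat, (3 <= w)%N -> (p w <= 2 ^ (w - 2) * lam)%N
    & (forall w : nat, (1 <= w)%N -> p w = (2 ^ (w - 1) * lam)%N) <->
        ~ condition_S Q /\ ~ condition_S (reflect_poly Q)].
Proof.
have Q_odd : oddz (lead_coef Q) by rewrite lead_coefE degQ.
have lam_ord : least_pos (fun k => in_ideal Q 1 ('X^k - 1)) lam.
  apply: least_pos_iff lam_order => k; rewrite ideal1P /eqmod_poly.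
  by rewrite /red2 rmorphB.
have [lam_gt0 lamI _] := lam_ord.
have lam_odd := order_odd _ Q_irr _ lam_ord.
have p_ord w : (1 <= w)%N -> least_pos (fun k => in_ideal Q w ('X^k - 1)) (p w).
  move=> w1; apply: least_pos_iff (p_period _ w1) => k.
  apply: (@eventual_shift_ideal _ _ _ Q_irr _ _ lam) => //.
    apply: seq_eval_dvdM => n; rewrite seq_eval_XnM degQ.
    by have /eqP := x_rec _ w1 n; rewrite eqz_mod_dvd subr0.
  have [i xi] := x0_odd; exists i; apply: contra xi => xwi.
  have /eqP := x_init _ w1 i; rewrite eqz_mod_dvd => /(dvdz_trans _) d.
  have {d} d2 : (2 %| x w i - x0 i)%Z by apply: d; rewrite -(subnK w1) exprD dvdz_mull.
  by rewrite -(subKr (x w i) (x0 i)) rpredB.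
have p_le w n : (1 <= w)%N -> (0 < n)%N -> in_ideal Q w ('X^n - 1) -> (p w <= n)%N.
  by move=> /p_ord[_ _ pmin]; apply: pmin.
have pow_gt0 v : (0 < 2 ^ v * lam)%N by rewrite muln_gt0 expn_gt0.
have S_order := condition_S_order _ _ Q_irr Q_odd lam_odd lamI.
have S'_order := condition_S_reflect_order _ _ Q_irr Q_odd lam_odd lamI.
have part1 : condition_S (reflect_poly Q) ->
    forall w, (2 <= w)%N -> (p w <= 2 ^ (w - 2) * lam)%N.
  move=> /S'_order l2 w w2; apply: p_le => //; first exact: ltnW.
  rewrite mulnC exprM -{1}(subnKC w2); exact: ideal_iter_double.
have part2 : condition_S Q ->
    forall w, (3 <= w)%N -> (p w <= 2 ^ (w - 2) * lam)%N.
  move=> /S_order l2 w w3; apply: p_le => //; first by lia.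
  have l3 : in_ideal Q 3 ('X^lam ^+ 2 - 1).
    have -> : 'X^lam ^+ 2 - 1 = ('X^lam + 1) * ('X^lam + 1) - 2 * ('X^lam + 1)
      :> {poly int} by ring.
    apply: idealB (ideal_mul2 _ _ _ l2).
    by apply: (@idealW _ _ (2 + 2)) => //; apply: idealM.
  have -> : (w - 2 = (w - 3).+1)%N by lia.
  rewrite mulnC expnS !exprM -{1}(subnKC w3); exact: ideal_iter_double.
split=> //; split=> [pE|[nS nS'] w w1].
  by split=> [/part2/(_ 3 isT)|/part1/(_ 2 isT)]; rewrite pE // leq_pmul2r.
have [pw0 pwI pmin] := p_ord w w1.
have pw_dvd : (p w %| 2 ^ (w - 1) * lam)%N.
  apply: (order_dvd _ _ _ _ (p_ord w w1)).
  by rewrite mulnC exprM -{1}(subnKC w1); apply: ideal_iter_double.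
(* p_w is a multiple of lam dividing 2 ^ (w - 1) * lam, hence 2 ^ j * lam; a value
   j < w - 1 would give t ^ (2 ^ (w - 2) * lam) = 1 modulo (2 ^ w, Q). *)
have /dvdnP[m pwE] : (lam %| p w)%N.
  by apply: (order_dvd _ _ _ _ lam_ord); apply: idealW pwI.
move: pw_dvd; rewrite pwE dvdn_pmul2r // => /dvdn_pfactor[] // j jw mE.
move: jw; rewrite leq_eqVlt => /predU1P[<-|jw]; first by rewrite mE.
case: (@ideal_order_exact _ Q_irr (w - 2) 'X^lam) => //.
- by move/S'_order.
- by move/S_order.
have -> : (w - 2).+2 = w by lia.
have -> : (2 ^ (w - 2) = 2 ^ j * 2 ^ (w - 2 - j))%N.
  by rewrite -expnD; congr (2 ^ _)%N; lia.
rewrite -exprM mulnA [(lam * _)%N]mulnC -mE -pwE exprM; exact: ideal_expr1.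
Qed.
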